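(* Let $a<b$ and let $\gamma_{\mathrm{geo}}$ and $\gamma_{\mathrm{other}}$ be kinetically admissible paths on $[a,b]$ sharing endpoints, i.e. $\gamma_{\mathrm{geo}}(a)=\gamma_{\mathrm{other}}(a)$ and $\gamma_{\mathrm{geo}}(b)=\gamma_{\mathrm{other}}(b)$. Write $\xi_{\mathrm{geo}}:=\log\gamma_{\mathrm{geo}}$ and $\xi_{\mathrm{other}}:=\log\gamma_{\mathrm{other}}$. If $s_0\in(0,1]$ is such that $$\mathcal{A}[\gamma_{\mathrm{geo}}]\le\mathcal{A}[\mathrm{interp}^\times(\gamma_{\mathrm{geo}},\gamma_{\mathrm{other}},s_0)],$$ then $$\mathcal{A}[\gamma_{\mathrm{geo}}]\le\mathcal{A}[\gamma_{\mathrm{other}}]-\frac{1-s_0}{2}\int_a^b\bigl(\dot\xi_{\mathrm{geo}}(t)-\dot\xi_{\mathrm{other}}(t)\bigr)^2\,dt.$$ In particular $\mathcal{A}[\gamma_{\mathrm{geo}}]\le\mathcal{A}[\gamma_{\mathrm{other}}]$. Moreover, if $s_0\in(0,1)$, then the inequality $\mathcal{A}[\gamma_{\mathrm{geo}}]\le\mathcal{A}[\gamma_{\mathrm{other}}]$ is strict unless $\gamma_{\mathrm{other}}\equiv\gamma_{\mathrm{geo}}$ on $[a,b]$.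
   Context: For $a<b$, an admissible path on $[a,b]$ is an absolutely continuous function $\gamma:[a,b]\to(0,\infty)$ (strictly positive at every point) with $\dot\gamma\in L^2([a,b])$. Its log-coordinate is $\xi:=\log\gamma$, which is absolutely continuous with $\dot\xi=\dot\gamma/\gamma\in L^2([a,b])$. An admissible path $\gamma$ is kinetically admissible if $\int_a^b[\cosh(\dot\xi(t))-1]\,dt<\infty$. For a kinetically admissible path the kinetic action is $\mathcal{A}[\gamma]:=\int_a^b[\cosh(\dot\xi(t))-1]\,dt$. Geometric interpolation of admissible $\gamma_1,\gamma_2$ with $s\in[0,1]$ is $\mathrm{interp}^\times(\gamma_1,\gamma_2,s)(t):=\gamma_1(t)^{1-s}\gamma_2(t)^s$ (it is kinetically admissible whenever $\gamma_1,\gamma_2$ are). *)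

(* Defs.v *)
From HB Require Import structures.
From mathcomp Require Import all_boot all_order all_algebra.
From mathcomp Require Import all_classical all_reals all_analysis.
Set Implicit Arguments.
Unset Strict Implicit.
Unset Printing Implicit Defensive.
Import Order.TTheory GRing.Theory Num.Theory numFieldNormedType.Exports.
Local Open Scope classical_set_scope.
Local Open Scope ring_scope.

Definition cosh {R : realType} (x : R) : R := (expR x + expR (- x)) / 2.

Definition abs_cont {R : realType} (a b : R) (f : R -> R) : Prop :=
  forall e : R, 0 < e -> exists2 d : R, 0 < d &
    forall (n : nat) (l r : 'I_n -> R),
      (forall i, a <= l i /\ l i < r i /\ r i <= b) ->
      trivIset [set: 'I_n] (fun i => `]l i, r i[%classic) ->
      \sum_(i < n) (r i - l i) < d ->
      \sum_(i < n) `|f (r i) - f (l i)| < e.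

(* Paths on [a, b] are total functions R -> R of which only the values on [a, b]
   matter.  For an absolutely continuous f, derive1 f is the usual derivative
   almost everywhere and takes a fixed default value at the interior points of
   non-differentiability.  At a and b it may depend on the values outside
   [a, b], without effect on integrals. *)
Definition admissible {R : realType} (a b : R) (g : R -> R) : Prop :=
  [/\ forall t, t \in `[a, b] -> 0 < g t,
      abs_cont a b g &
      derive1 g \_ `[a, b] \in Lfun (@lebesgue_measure R) 2%:E].

Definition log_coord {R : realType} (g : R -> R) : R -> R :=
  fun t => ln (g t).

(* The value is in \bar R; for an admissible path it is finite exactly when the
   path is kinetically admissible. *)
Definition action {R : realType} (a b : R) (g : R -> R) : \bar R :=
  (\int[@lebesgue_measure R]_(t in `[a, b])
     (cosh (derive1 (log_coord g) t) - 1)%:E)%E.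

Definition kin_admissible {R : realType} (a b : R) (g : R -> R) : Prop :=
  admissible a b g /\ (action a b g < +oo)%E.

Definition geo_interp {R : realType} (g1 g2 : R -> R) (s : R) : R -> R :=
  fun t => g1 t `^ (1 - s) * g2 t `^ s.

(* Main.v *)
(* An absolutely continuous f is the difference of its total variation V and of
   V - f, both nondecreasing and absolutely continuous.  The Stieltjes measure of
   such a function is dominated by Lebesgue measure, so Radon-Nikodym and Lebesgue
   differentiation give f x = f a + \int_a^x h with f' = h almost everywhere.
   Applied to the log-coordinates, this makes the geometric interpolation linear
   in the velocities almost everywhere.  Since cosh x - x^2 / 2 is convex,
     A[interp_s] + s (1 - s) / 2 * \int (h_geo - h_other)^2
       <= (1 - s) A[geo] + s A[other],
   and the hypothesis at s = s0 gives the gap after division by s0.  If the gap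
   integral vanishes, the velocities agree almost everywhere, hence so do the
   paths, which start at the same point. *)

Require Import Defs.
From HB Require Import structures.
From mathcomp Require Import all_boot all_order all_algebra.
From mathcomp Require Import all_classical all_reals all_analysis.
From mathcomp Require Import measurable_realfun ring lra.
Import Order.TTheory GRing.Theory Num.Theory numFieldNormedType.Exports.
Local Open Scope classical_set_scope.
Local Open Scope ring_scope.

(** * Absolute continuity and total variation *)

(** Degenerate intervals add nothing to either sum, so enumerating the others reduces to ['I_n].
    Product index types and clamped endpoints below need this extra freedom. *)
Lemma abs_cont_finType (R : realType) (a b : R) (f : R -> R) :
  abs_cont a b f -> forall e : R, 0 < e -> exists2 d : R, 0 < d &
    forall (I : finType) (l r : I -> R),
      (forall i, [/\ a <= l i, l i <= r i & r i <= b]) ->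
      trivIset [set: I] (fun i => `]l i, r i[%classic) ->
      \sum_i (r i - l i) < d ->
      \sum_i `|f (r i) - f (l i)| < e.
Proof.
move=> acf e /acf[d d0 fd]; exists d => // I l r lr tI.
pose P := [pred i | l i < r i].
have sumP (F : I -> R) : (forall i, l i = r i -> F i = 0) ->
    \sum_i F i = \sum_(k < #|P|) F (enum_val k).
  move=> F0; rewrite -(big_enum_val (A := P)) [RHS]big_mkcond/=.
  apply: eq_bigr => i _; case: ifPn => //; rewrite inE -leNgt => ri.
  by apply: F0; apply/eqP; rewrite eq_le ri andbT; have [] := lr i.
rewrite !sumP; [|by move=> i ->; rewrite subrr ?normr0..].
apply: fd => [i|i j _ _ /(tI _ _ Logic.I Logic.I)/enum_val_inj//].
by have [? _ ?] := lr (enum_val i); have := enum_valP i; rewrite inE.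
Qed.

Section partition_points.
Context {R : realType}.
Variables (a b : R) (s : seq R).
Hypothesis abs : itv_partition a b s.
(** The default value [b] keeps [u] constant from index [size s] on, so partitions of different
    lengths can be padded to a common one. *)
Let u := nth b (a :: s).

Lemma itv_partition_nth_homo : {homo u : m n / (m <= n)%N >-> m <= n}.
Proof.
apply: homo_leq => [//|//|k]; first exact: le_trans.
have [ks|ks] := ltnP k (size s).
  exact: (@nondecreasing_fun_itv_partition _ _ a b idfun s).
rewrite /u [leRHS]nth_default//.
move: ks; rewrite leq_eqVlt => /predU1P[<-|ks]; last by rewrite nth_default.
by rewrite (itv_partition_nth_size _ abs).
Qed.

Lemma itv_partition_nth_default n : (size s <= n)%N -> u n = b.
Proof.
rewrite leq_eqVlt => /predU1P[<-|ns]; last by rewrite /u nth_default.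
exact: itv_partition_nth_size abs.
Qed.

Lemma itv_partition_nth_itv n : a <= u n <= b.
Proof.
rewrite -{1}[a]/(u 0%N) itv_partition_nth_homo//=.
have [ns|/ltnW ns] := leqP (size s) n; first by rewrite itv_partition_nth_default.
by rewrite -(itv_partition_nth_default _ (leqnn _)) itv_partition_nth_homo.
Qed.

End partition_points.

(* The partitions are flattened into one family of intervals indexed by I * 'I_M,
   each being padded with degenerate intervals at its right endpoint. *)
Lemma abs_cont_variation (R : realType) (a b : R) (f : R -> R) :
  abs_cont a b f -> forall e : R, 0 < e -> exists2 d : R, 0 < d &
    forall (I : finType) (l r : I -> R) (s : I -> seq R),
      (forall i, [/\ a <= l i, l i <= r i & r i <= b]) ->
      (forall i, itv_partition (l i) (r i) (s i)) ->
      trivIset [set: I] (fun i => `]l i, r i[%classic) ->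
      \sum_i (r i - l i) < d ->
      \sum_i variation (l i) (r i) f (s i) < e.
Proof.
move=> /abs_cont_finType acf e /acf[d d0 fd]; exists d => // I l r s lr ps tI lrd.
pose M := (\max_i size (s i))%N.
have sM i : (size (s i) <= M)%N by exact: leq_bigmax.
pose u i n := nth (r i) (l i :: s i) n.
have uitv i n : l i <= u i n <= r i by exact: itv_partition_nth_itv.
have umono i : {homo u i : m n / (m <= n)%N >-> m <= n}.
  exact: itv_partition_nth_homo.
have /= := fd (I * 'I_M)%type (fun p => u p.1 p.2) (fun p => u p.1 p.2.+1).
have pairE (F : I -> nat -> R) :
    \sum_(p : I * 'I_M) F p.1 p.2 = \sum_i \sum_(0 <= n < M) F i n.
  by under [RHS]eq_bigr do rewrite big_mkord; rewrite pair_bigA.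
rewrite (pairE (fun i n => u i n.+1 - u i n)).
rewrite (pairE (fun i n => `|f (u i n.+1) - f (u i n)|)).
move=> h; apply: le_lt_trans (h _ _ _).
- apply: ler_sum => i _; rewrite /variation [leRHS](@big_cat_nat _ _ _ (size (s i)))//= lerDl.
  by apply: sumr_ge0.
- move=> [i n]/=; have [ali _ rib] := lr i; have /andP[lu _] := uitv i n.
  have /andP[_ ur] := uitv i n.+1.
  by rewrite (le_trans ali lu) (le_trans ur rib) umono.
(* A point common to two cells lies in both ambient intervals, whence [i = j]; monotonicity of [u i]
   then excludes [n < m] and [m < n]. *)
- move=> [i n] [j m] _ _ [x []]/=; rewrite !in_itv/= => /andP[x1 x2] /andP[x3 x4].
  have ij : i = j.
    apply: tI => //; exists x; split; rewrite /= in_itv/=.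
      have /andP[lu _] := uitv i n; have /andP[_ ur] := uitv i n.+1.
      by rewrite (le_lt_trans lu x1) (lt_le_trans x2 ur).
    have /andP[lu _] := uitv j m; have /andP[_ ur] := uitv j m.+1.
    by rewrite (le_lt_trans lu x3) (lt_le_trans x4 ur).
  rewrite -{j}ij in x3 x4 *; congr pair; apply/ord_inj/eqP.
  rewrite eqn_leq; apply/andP; split; rewrite leqNgt; apply/negP => /(umono i) nm.
    by have := lt_trans (lt_le_trans x4 nm) x1; rewrite ltxx.
  by have := lt_trans (lt_le_trans x2 nm) x3; rewrite ltxx.
- rewrite (eq_bigr (fun i => r i - l i))// => i _.
  by rewrite telescope_sumr// /u (itv_partition_nth_default _ _ _ (ps i)).
Qed.

(** Taking [e = 1], the variation is at most 1 on any subinterval shorter than [d], and finitely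
    many of these cover the interval. *)
Lemma abs_cont_bounded_variation (R : realType) (a b : R) (f : R -> R) :
  abs_cont a b f -> bounded_variation a b f.
Proof.
move=> acf; have [ba|ab] := leP b a.
  move: ba; rewrite le_eqVlt => /predU1P[->|ba]; first exact: bounded_variationxx.
  by exists 0 => _ [s /itv_partition_le + <-]; rewrite leNgt ba.
have [d d0 fd] := abs_cont_variation _ _ _ _ acf _ ltr01.
have loc x y : a <= x -> x <= y -> y <= b -> y - x < d ->
    total_variation x y f \is a fin_num.
  move=> ax xy yb yxd; apply/bounded_variationP => //.
  exists 1 => _ [s xys <-]; apply/ltW.
  have := fd 'I_1 (fun=> x) (fun=> y) (fun=> s); rewrite !big_ord1.
  by apply => // i j _ _ _; rewrite !ord1.
(* Induction on the number of steps of length [d / 2], which is strictly below the [d] required by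
   [loc]. *)
suff H n x : a <= x -> x <= b -> x - a < (d / 2) *+ n ->
    total_variation a x f \is a fin_num.
  apply/bounded_variationP; first exact: ltW.
  apply: (H (Num.bound ((b - a) / (d / 2)))); [exact: ltW|exact: lexx|].
  rewrite -mulr_natl -ltr_pdivrMr ?divr_gt0//.
  by rewrite archi_boundP// divr_ge0// ?subr_ge0; lra.
elim: n x => [x ax _|n IH x ax xb xn].
  by rewrite mulr0n subr_lt0 ltNge ax.
have [xa|xa] := leP (x - d / 2) a.
  by apply: loc => //; lra.
have ax' := ltW xa; have x'x : x - d / 2 <= x by rewrite gerBl; lra.
rewrite (total_variationD f ax' x'x) fin_numD; apply/andP; split.
  by apply: IH => //; [exact: le_trans x'x xb|move: xn; rewrite mulrSr; lra].
by apply: loc => //; lra.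
Qed.

(** The bound of [abs_cont_variation] is uniform in the partitions, so it passes to the suprema,
    where it becomes a weak inequality. *)
Lemma abs_cont_total_variation_le (R : realType) (a b : R) (f : R -> R) :
  abs_cont a b f -> forall e : R, 0 < e -> exists2 d : R, 0 < d &
    forall (I : finType) (l r : I -> R),
      (forall i, [/\ a <= l i, l i <= r i & r i <= b]) ->
      trivIset [set: I] (fun i => `]l i, r i[%classic) ->
      \sum_i (r i - l i) < d ->
      \sum_i fine (total_variation (l i) (r i) f) <= e.
Proof.
move=> acf e /(abs_cont_variation _ _ _ _ acf)[d d0 fd]; exists d => //.
move=> I l r lr tI lrd; apply/ler_addgt0Pr => eps eps0.
have BVf i : bounded_variation (l i) (r i) f.
  have [al ilr rb] := lr i.
  apply: (bounded_variationr al ilr); apply: bounded_variationl rb _.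
    exact: le_trans ilr.
  exact: abs_cont_bounded_variation.
(* Each interval is allowed an error [k], for a total of at most [eps]; the successor keeps the
   denominator positive when [I] is empty. *)
pose k := eps / #|I|.+1%:R.
have k0 : 0 < k by rewrite divr_gt0.
have /choice[s ps] : forall i, exists s, itv_partition (l i) (r i) s /\
    fine (total_variation (l i) (r i) f) <= variation (l i) (r i) f s + k.
  move=> i; have [_ ilr _] := lr i.
  have fin : total_variation (l i) (r i) f \is a fin_num.
    exact/bounded_variationP.
  have [_ [_ [s ps <-] <-]] := ub_ereal_sup_adherent k0 fin.
  rewrite -/(total_variation _ _ _) -(fineK fin) -EFinB lte_fin ltrBlDr => sk.
  by exists s; split => //; exact: ltW.
apply: (@le_trans _ _ (\sum_i (variation (l i) (r i) f (s i) + k))).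
  by apply: ler_sum => i _; exact: (ps i).2.
rewrite big_split/= lerD//.
  by apply/ltW/fd => // i; exact: (ps i).1.
rewrite sumr_const -mulr_natr /k -mulrA ger_pMr// ler_pdivrMl//.
by rewrite mulr1 ler_nat.
Qed.

(** By additivity, the increment over each interval is the total variation of [f] there. Using
    [e / 2] restores the strict inequality. *)
Lemma abs_cont_total_variation (R : realType) (a b : R) (f : R -> R) :
  abs_cont a b f -> abs_cont a b (fine \o total_variation a ^~ f).
Proof.
move=> acf e e0.
have e20 : 0 < e / 2 by rewrite divr_gt0.
have [d d0 fd] := abs_cont_total_variation_le _ _ _ _ acf _ e20.
have fin x y : a <= x -> x <= y -> y <= b ->
    total_variation x y f \is a fin_num.
  move=> ax xy yb; apply/bounded_variationP => //.
  apply: (bounded_variationr ax xy); apply: bounded_variationl yb _.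
    exact: le_trans xy.
  exact: abs_cont_bounded_variation.
exists d => // n l r lr tI lrd.
rewrite (eq_bigr (fun i => fine (total_variation (l i) (r i) f))).
  apply: (@le_lt_trans _ _ (e / 2)); last by rewrite ltr_pdivrMr// ltr_pMr//; lra.
  by apply: fd => // i; have [? [/ltW]] := lr i.
move=> i _ /=; have [al [/ltW ilr rb]] := lr i.
rewrite (total_variationD f al ilr) fineD ?fin//; last exact: le_trans rb.
by rewrite addrC addKr ger0_norm// fine_ge0// total_variation_ge0.
Qed.

Lemma abs_contB (R : realType) (a b : R) (f g : R -> R) :
  abs_cont a b f -> abs_cont a b g -> abs_cont a b (f \- g).
Proof.
move=> acf acg e e0; have e20 : 0 < e / 2 by rewrite divr_gt0.
have [d1 d10 fd] := acf _ e20; have [d2 d20 gd] := acg _ e20.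
exists (Num.min d1 d2); first by rewrite lt_min d10.
move=> n l r lr tI; rewrite lt_min => /andP[lr1 lr2].
rewrite (splitr e) (le_lt_trans _ (ltrD (fd _ _ _ lr tI lr1) (gd _ _ _ lr tI lr2)))//.
rewrite -big_split/=; apply: ler_sum => i _.
have -> : f (r i) - g (r i) - (f (l i) - g (l i)) =
  (f (r i) - f (l i)) - (g (r i) - g (l i)) by ring.
exact: ler_normB.
Qed.

Lemma abs_cont_dist (R : realType) (a b : R) (f : R -> R) :
  abs_cont a b f -> forall e : R, 0 < e -> exists2 d : R, 0 < d &
    forall x y, a <= x -> x <= y -> y <= b -> y - x < d -> `|f y - f x| < e.
Proof.
move=> /abs_cont_finType acf e /acf[d d0 fd]; exists d => // x y ax xy yb yxd.
have := fd 'I_1 (fun=> x) (fun=> y); rewrite !big_ord1.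
by apply => // i j _ _ _; rewrite !ord1.
Qed.

(** * Stieltjes measures and densities of absolutely continuous functions *)

Section bounded_stieltjes.
Context {R : realType}.
Variables (F : cumulative R R) (m M : R).
Hypothesis Fitv : forall x, m <= F x <= M.
Local Notation mu := (lebesgue_stieltjes_measure F).

Lemma lebesgue_stieltjes_measure_itv_oc (x y : R) : x <= y ->
  mu `]x, y]%classic = (F y - F x)%:E.
Proof.
move=> xy; rewrite /mu/= /lebesgue_stieltjes_measure /measure_extension.
by rewrite measurable_mu_extE/= ?wlength_itv_bnd//; exact: is_ocitv.
Qed.

(** Continuity from below along the intervals []-n, n]], each of mass at most [M - m]. The resulting
    finiteness is what Radon-Nikodym asks for. *)
Lemma lebesgue_stieltjes_measure_bounded : (mu setT <= (M - m)%:E)%E.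
Proof.
rewrite -(bigcup_itvT false false).
pose I n : set R := `]- (n%:R), n%:R]%classic.
have cI : (mu \o I) n @[n --> \oo] --> mu (\bigcup_n I n).
  apply: nondecreasing_cvg_mu; rewrite /I//; first exact: bigcup_measurable.
  by move=> *; apply/subsetPset/subset_itv; rewrite leBSide/= ?lerN2 ler_nat.
rewrite -(cvg_lim _ cI)//; apply: lime_le; first by apply/cvg_ex; eexists; exact: cI.
apply: nearW => n /=; rewrite lebesgue_stieltjes_measure_itv_oc ?ge0_cp//.
have /andP[_ FM] := Fitv n%:R; have /andP[mF _] := Fitv (- n%:R).
by rewrite lee_fin lerB.
Qed.

Lemma lebesgue_stieltjes_measure_fin_num : fin_num_fun mu.
Proof.
apply: lty_fin_num_fun.
exact: le_lt_trans lebesgue_stieltjes_measure_bounded (ltry _).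
Qed.

(** The density is the Radon-Nikodym derivative, made real-valued by [fine]; evaluating the measure
    on []x, y]] gives the increments of [F]. *)
Lemma stieltjes_density : mu `<< @lebesgue_measure R ->
  exists2 h : R -> R, (@lebesgue_measure R).-integrable setT (EFin \o h) &
  forall x y, x <= y -> F y - F x = (\int[@lebesgue_measure R]_(t in `]x, y]) h t)%R.
Proof.
pose nu : {finite_measure set (measurableTypeR R) -> \bar R} :=
  HB.pack mu (Measure_isFinite.Build _ _ _ mu lebesgue_stieltjes_measure_fin_num).
move=> dom.
pose f := Radon_Nikodym (charge_of_finite_measure nu) (@lebesgue_measure R).
have finf x : f x \is a fin_num by exact: Radon_Nikodym_fin_num.
have fE : EFin \o (fine \o f) = f by apply/funext => x /=; rewrite fineK.
exists (fine \o f); first by rewrite fE; exact: Radon_Nikodym_integrable.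
move=> x y xy; rewrite /Rintegral.
rewrite (_ : (fun t => ((fine \o f) t)%:E) = f) // -Radon_Nikodym_integral//=.
by rewrite lebesgue_stieltjes_measure_itv_oc.
Qed.

End bounded_stieltjes.

(** An open interval is the interior of its hull, and finite measure excludes infinite ends. This
    supplies endpoints for the components of an open set. *)
Lemma open_interval_bounded (R : realType) (A : set R) : open A ->
  is_interval A -> (lebesgue_measure A < +oo)%E -> A !=set0 ->
  exists x y, x < y /\ A = `]x, y[%classic.
Proof.
move=> oA /is_intervalP AE Afin [z Az].
have {oA} : A = [set` Rhull A]° by rewrite -AE; exact/esym/interior_id.
have {Afin} : (lebesgue_measure [set` Rhull A] < +oo)%E by rewrite -AE.
have {AE} : z \in Rhull A by move: Az; rewrite {1}AE.
case: (Rhull A) => -[p x|[]] [q y|[]]; rewrite in_itv lebesgue_measure_itv//= ?andbF//.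
- move=> _ _; rewrite interior_itv => AE; exists x, y; split => //.
  by move: Az; rewrite AE /= in_itv/= => /andP[]; exact: lt_trans.
- by rewrite ltry.
- by rewrite ltNyr.
Qed.

(** A Lebesgue-null set lies in an open set of measure below the [d] of absolute continuity. The
    components of that set are disjoint intervals, over which the increments sum to at most [e];
    hence the Stieltjes measure is dominated. *)
Lemma nondecreasing_abs_cont_density (R : realType) (a b : R) (f : R -> R) :
  a < b -> abs_cont a b f -> {in `[a, b] &, {homo f : x y / x <= y}} ->
  exists2 h : R -> R, (@lebesgue_measure R).-integrable setT (EFin \o h) &
  forall x, a <= x <= b ->
    f x - f a = (\int[@lebesgue_measure R]_(t in `]a, x]) h t)%R.
Proof.
move=> ab acf ndf.
(* Clamping to [[a, b]] extends [f] to a bounded, nondecreasing, right-continuous function on the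
   whole line. *)
pose c x := Num.max a (Num.min x b).
have citv x : a <= c x <= b.
  by rewrite /c le_max lexx ge_max (ltW ab) ge_min lexx orbT.
have cin x : c x \in `[a, b] by rewrite in_itv/= citv.
have cid x : a <= x <= b -> c x = x.
  by move=> /andP[ax xb]; rewrite /c min_l// max_r.
have cmono x y : x <= y -> 0 <= c y - c x <= y - x.
  move=> xy; have xc : Num.min x b <= c x by rewrite /c le_max lexx orbT.
  rewrite subr_ge0 lerBlDl; apply/andP; split.
    rewrite {1}/c ge_max; have /andP[-> _] := citv y.
    by rewrite le_max le_min !ge_min xy lexx !orbT.
  rewrite {1}/c ge_max; have /andP[acx _] := citv x.
  apply/andP; split; first lra.
  move: xc; case: (leP x b) => xb xc; rewrite ge_min; apply/orP; [left|right]; lra.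
have cioo x y z : c x < z < c y -> x < z < y.
  rewrite /c gt_max lt_max gt_min lt_min => /andP[/andP[az /orP[xz|bz]]] /orP[za|/andP[zy zb]];
    by apply/andP; split; lra.
have Fmono : {homo (f \o c) : x y / x <= y}.
  by move=> x y /cmono/andP[cxy _]; apply: ndf => //; rewrite -subr_ge0.
have Frc : forall x, (f \o c) y @[y --> x^'+] --> (f \o c) x.
  move=> x; apply/cvgrPdist_lt => e e0.
  have [d d0 fd] := abs_cont_dist _ _ _ _ acf _ e0.
  near=> y; rewrite distrC /=.
  have xy : x < y by [].
  have /andP[cxy cyx] := cmono _ _ (ltW xy).
  have /andP[acx _] := citv x; have /andP[_ cyb] := citv y.
  apply: fd => //; first by rewrite -subr_ge0.
  apply: le_lt_trans cyx _; rewrite ltrBlDr addrC; near: y.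
  by apply: nbhs_right_lt; rewrite ltrDl.
pose F : cumulative R R := HB.pack (f \o c) (isCumulative.Build R _ R (f \o c) Fmono Frc).
have Fitv x : f a <= F x <= f b.
  by rewrite /F/= !ndf// ?in_itv/= ?lexx ?(ltW ab) ?andbT//; have /andP[] := citv x.
have Fdom : lebesgue_stieltjes_measure F `<< @lebesgue_measure R.
  apply/null_content_dominatesP => N mN N0.
  apply/eqP; rewrite eq_le measure_ge0 andbT.
  apply/lee_addgt0Pr => e e0; rewrite add0e.
  have [d d0 fd] := abs_cont_finType _ _ _ _ acf _ e0.
  have [|U [oU NU Ud]] := @lebesgue_regularity_outer R N d mN _ d0; first by rewrite N0.
  have mU : measurable U by exact: open_measurable.
  have {Ud} Ud : (lebesgue_measure U < d%:E)%E.
    rewrite -(setDKU NU); apply: (@le_lt_trans _ _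
      (lebesgue_measure (U `\` N) + lebesgue_measure N)%E).
      by apply: measureU2 => //; exact: measurableD.
    by rewrite /= N0 adde0.
  pose I := open_disjoint_itv oU.
  have mI k : measurable (I k) by apply: open_measurable; exact: open_disjoint_itv_open.
  have IU : U = \bigcup_k I k by exact: open_disjoint_itv_bigcup.
  have tI : trivIset setT I by exact: open_disjoint_itv_trivIset.
  (* [p k] holds the endpoints of the component [I k]; an empty component receives the degenerate
     pair [(a, a)]. *)
  have /choice[p lrI] : forall k, exists p : R * R, p.1 <= p.2 /\
     `]p.1, p.2[%classic `<=` I k /\
     (lebesgue_stieltjes_measure F (I k) <= (F p.2 - F p.1)%:E)%E /\
     lebesgue_measure (I k) = (p.2 - p.1)%:E.
    move=> k; have [->|/set0P Ik0] := eqVneq (I k) set0.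
      exists (a, a) => /=; rewrite !subrr !measure0; split => //; split => //.
      by rewrite set_itvoo0.
    have [||||x [y [xy Ixy]]] := open_interval_bounded _ (I k).
    - exact: open_disjoint_itv_open.
    - exact: open_disjoint_itv_is_interval.
    - apply: le_lt_trans (lt_trans Ud (ltry _)); apply: le_measure; rewrite ?inE//.
        exact: mI.
      by rewrite IU; exact: bigcup_sup.
    - exact: Ik0.
    exists (x, y) => /=; rewrite ltW// Ixy; split => //; split => //; split.
      apply: (@le_trans _ _ (lebesgue_stieltjes_measure F `]x, y]%classic)).
        by apply: le_measure; rewrite ?inE; [exact: measurable_itv..|exact: subset_itv_oo_oc].
      by rewrite (lebesgue_stieltjes_measure_itv_oc F _ _ (ltW xy)).
    by rewrite lebesgue_measure_itv/= lte_fin xy.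
  apply: (@le_trans _ _ (lebesgue_stieltjes_measure F U)).
    by apply: le_measure => //; rewrite inE.
  rewrite IU measure_semi_bigcup//; last by rewrite -IU.
  apply: lime_le; first exact: is_cvg_nneseries.
  apply: nearW => n.
  apply: (@le_trans _ _ (\sum_(0 <= k < n) (F (p k).2 - F (p k).1)%:E)%E).
    by apply: lee_sum => k _; have [_ [_ []]] := lrI k.
  rewrite sumEFin lee_fin big_mkord.
  (* [F] at an endpoint is [f] at the clamped endpoint. Clamping does not lengthen intervals and, by
     [cioo], keeps them disjoint, so absolute continuity on [[a, b]] applies. *)
  apply: le_trans (ltW (fd 'I_n (fun k => c (p k).1) (fun k => c (p k).2) _ _ _)).
  - by apply: ler_sum => k _; exact: ler_norm.
  - move=> k; have [/cmono/andP[+ _] _] := lrI k; rewrite subr_ge0 => ->.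
    by have /andP[-> _] := citv (p k).1; have /andP[_ ->] := citv (p k).2.
  - move=> i j _ _ [x []]/=; rewrite !in_itv/= => xi xj.
    apply/ord_inj/tI => //; exists x; split.
      by apply: (lrI i).2.1; rewrite /= in_itv/= cioo.
    by apply: (lrI j).2.1; rewrite /= in_itv/= cioo.
  - rewrite -lte_fin; apply: le_lt_trans Ud.
    apply: (@le_trans _ _ (\sum_(0 <= k < n) lebesgue_measure (I k))%E).
      rewrite -sumEFin big_mkord; apply: lee_sum => k _.
      have [/cmono/andP[_ +] [_ [_ ->]]] := lrI k.
      by rewrite lee_fin.
    rewrite IU measure_semi_bigcup//; last by rewrite -IU.
    exact: nneseries_lim_ge.
have [h ih hE] := stieltjes_density F (f a) (f b) Fitv Fdom.
exists h => // x axb; have /andP[ax xb] := axb.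
by rewrite -hE// /F/= !cid// ?lexx// ltW.
Unshelve. all: by end_near. Qed.

Lemma abs_cont_density (R : realType) (a b : R) (f : R -> R) :
  a < b -> abs_cont a b f ->
  exists2 h : R -> R, (@lebesgue_measure R).-integrable setT (EFin \o h) &
  forall x, a <= x <= b ->
    f x = f a + (\int[@lebesgue_measure R]_(t in `]a, x]) h t)%R.
Proof.
move=> ab acf; have BVf := abs_cont_bounded_variation _ _ _ _ acf.
pose V := fine \o total_variation a ^~ f.
have acV : abs_cont a b V by exact: abs_cont_total_variation.
(* This bound makes both [V] and [V \- f] nondecreasing. *)
have Vle x y : a <= x -> x <= y -> y <= b -> `|f y - f x| <= V y - V x.
  move=> ax xy yb.
  have fin u v : a <= u -> u <= v -> v <= b -> total_variation u v f \is a fin_num.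
    move=> au uv vb; apply/bounded_variationP => //.
    by apply: (bounded_variationr au uv); apply: bounded_variationl vb BVf; exact: le_trans uv.
  rewrite /V /= (total_variationD f ax xy) fineD ?fin//; last exact: le_trans yb.
  rewrite [leRHS]addrC addKr -lee_fin fineK ?fin//; exact: total_variation_ge.
have ndV : {in `[a, b] &, {homo V : x y / x <= y}}.
  move=> x y; rewrite !in_itv/= => /andP[ax _] /andP[_ yb] xy.
  by rewrite -subr_ge0 (le_trans _ (Vle _ _ ax xy yb)).
have ndW : {in `[a, b] &, {homo (V \- f) : x y / x <= y}}.
  move=> x y; rewrite !in_itv/= => /andP[ax _] /andP[_ yb] xy.
  have := le_trans (ler_norm _) (Vle _ _ ax xy yb); rewrite /=; lra.
have [hV ihV hVE] := nondecreasing_abs_cont_density _ _ _ _ ab acV ndV.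
have [hW ihW hWE] :=
  nondecreasing_abs_cont_density _ _ _ _ ab (abs_contB _ _ _ _ _ acV acf) ndW.
exists (hV \- hW); first exact: (integrableB measurableT ihV ihW).
move=> x axb; rewrite RintegralB//; [|exact: integrableS ihV|exact: integrableS ihW].
by rewrite -hVE// -hWE//=; ring.
Qed.

(** Lebesgue differentiation of the primitive of [h]. The integral formula describes [f] on [[a, b]]
    only, so the derivative is transferred at interior points, where the two functions agree
    nearby. *)
Lemma ae_is_derive_of_density (R : realType) (a b : R) (f h : R -> R) :
  (@lebesgue_measure R).-integrable setT (EFin \o h) ->
  (forall x, a <= x <= b ->
    f x = f a + (\int[@lebesgue_measure R]_(t in `]a, x]) h t)%R) ->
  {ae @lebesgue_measure R, forall t, t \in `]a, b[ -> is_derive t 1 f (h t)}.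
Proof.
move=> ih fE.
have intf y : (@lebesgue_measure R).-integrable
    [set` Interval (BRight a) (BRight y)] (EFin \o h).
  exact: integrableS ih.
have locf : locally_integrable setT h.
  by apply: open_integrable_locally => //; exact: openT.
have := FTC1 intf locf; apply: filterS;
  first exact: (ae_filter_ringOfSetsType (@lebesgue_measure R)).
move=> t ht.
rewrite in_itv/= => /andP[at_ tb].
have [dG G't] := ht at_.
have fG : \near t, f a + (\int[@lebesgue_measure R]_(x in `]a, t]) h x)%R = f t.
  near=> x; rewrite [RHS]fE//; apply/andP; split; apply/ltW; near: x.
    exact: lt_nbhsr.
  exact: lt_nbhsl.
apply: near_eq_is_derive fG _.
have dG1 := DeriveDef dG erefl.
apply: is_derive_eq.
by rewrite add0r mul1r -derive1E.
Unshelve. all: by end_near. Qed.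

(** * Strong convexity of [cosh] *)

Lemma cosh_ge1 (R : realType) (x : R) : 1 <= cosh x.
Proof. by rewrite /cosh; have := expR_ge1Dx x; have := expR_ge1Dx (- x); lra. Qed.

(** The function [cosh z - z ^+ 2 / 2] is convex, its second derivative being [cosh z - 1 >= 0]. The
    quadratic term is exactly the convexity defect of [z ^+ 2 / 2]. *)
Lemma cosh_sub_sqr_convex (R : realType) (s x y : R) : 0 <= s <= 1 ->
  cosh ((1 - s) * x + s * y) + s * (1 - s) / 2 * (x - y) ^+ 2 <=
  (1 - s) * cosh x + s * cosh y.
Proof.
(* The claim is invariant under exchanging [x] with [y] and [s] with [1 - s]. *)
move=> /andP[s0 s1]; wlog yx : s x y s0 s1 / y <= x.
  move=> H; have [|/ltW xy] := leP y x; first exact: H.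
  have := H (1 - s) y x; rewrite subr_ge0 s1 gerBl s0 => /(_ erefl erefl xy).
  rewrite subKr => h; rewrite [X in cosh X]addrC.
  have -> : (x - y) ^+ 2 = (y - x) ^+ 2 by ring.
  lra.
pose f (z : R) : R^o := cosh z - z ^+ 2 / 2.
have f1 (z : R^o) : is_derive z (1:R^o) f ((expR z - expR (- z)) / 2 - z).
  by rewrite /f /cosh; apply: is_derive_eq; rewrite /GRing.scale/=; field.
have Df : 'D_(1:R^o) f = fun z : R^o => (expR z - expR (- z)) / 2 - z.
  by apply/funext => z; rewrite derive_val.
have f2 (z : R^o) : is_derive z (1:R^o)
    (fun u : R^o => (expR u - expR (- u)) / 2 - u : R^o) (cosh z - 1).
  by rewrite /cosh; apply: is_derive_eq; rewrite /GRing.scale/=; field.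
have fc (z : R^o) : {for z, continuous f}.
  exact/differentiable_continuous/derivable1_diffP/ex_derive.
have fconv : f (s * y + (1 - s) * x) <= s * f y + (1 - s) * f x.
  apply: (@second_derivative_convex R f y x _ _ _ _ _ (Itv01 s0 s1) yx).
  - move=> z _; rewrite Df derive_val subr_ge0; exact: cosh_ge1.
  - exact/cvg_at_left_filter/fc.
  - exact/cvg_at_right_filter/fc.
  - by move=> z _; exact: ex_derive.
  - by move=> z _; rewrite Df; exact: ex_derive.
rewrite addrC [X in cosh X]addrC; move: fconv; rewrite /f.
set P := cosh _; set Q := cosh _ ; set S := cosh _.
by move=> ?; lra.
Qed.

(** * Absolute continuity of log-coordinates *)

Lemma abs_cont_within_continuous (R : realType) (a b : R) (f : R -> R) :
  abs_cont a b f -> {within `[a, b], continuous f}.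
Proof.
move=> acf; apply/subspace_continuousP => x xab; apply/cvgrPdist_lt => e e0.
have [d d0 fd] := abs_cont_dist _ _ _ _ acf _ e0.
near=> y.
have yab : y \in `[a, b] by near: y; exact: withinT.
have : `|x - y| < d.
  by near: y; apply: cvg_within; apply: nbhsx_ballx.
move: xab yab; rewrite /= !in_itv/= => /andP[ax xb] /andP[ay yb].
have [xy|/ltW yx] := leP x y => xyd.
  by rewrite distrC fd// -(ger0_norm (_ : 0 <= y - x)) ?subr_ge0// distrC.
by rewrite fd// -(ger0_norm (_ : 0 <= x - y)) ?subr_ge0.
Unshelve. all: by end_near. Qed.

(** For [x <= y], [ln y - ln x = ln (1 + (y - x) / x) <= (y - x) / x], and [x] is at least [m]. *)
Lemma ln_lipschitz (R : realType) (m x y : R) : 0 < m -> m <= x -> m <= y ->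
  `|ln y - ln x| <= m^-1 * `|y - x|.
Proof.
move=> m0; wlog xy : x y / x <= y.
  move=> H mx my; have [xy|/ltW yx] := leP x y; first exact: H.
  by rewrite distrC (distrC y) H.
move=> mx my; have x0 : 0 < x by exact: lt_le_trans mx.
have y0 : 0 < y by exact: lt_le_trans my.
rewrite ger0_norm ?subr_ge0 ?ler_ln// ger0_norm ?subr_ge0// -ln_div//.
have -> : y / x = 1 + (y - x) / x by field; rewrite gt_eqF.
have yx0 : 0 <= (y - x) / x by rewrite divr_ge0 ?subr_ge0// ltW.
apply: le_trans (le_ln1Dx _) _; first by rewrite (lt_le_trans _ yx0)// ltrN10.
by rewrite mulrC ler_wpM2r ?subr_ge0// lef_pV2.
Qed.

(** By compactness [g] attains a positive minimum [g c] on [[a, b]], and [ln] is Lipschitz with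
    constant [(g c)^-1] above it. *)
Lemma abs_cont_log_coord (R : realType) (a b : R) (g : R -> R) : a <= b ->
  (forall t, t \in `[a, b] -> 0 < g t) -> abs_cont a b g ->
  abs_cont a b (log_coord g).
Proof.
move=> ab g0 acg.
have [c cab gc] := EVT_min ab (abs_cont_within_continuous _ _ _ _ acg).
move=> e e0; have ec0 : 0 < e * g c by rewrite mulr_gt0// g0.
have [d d0 gd] := acg _ ec0; exists d => // n l r lr tI lrd.
apply: (@le_lt_trans _ _ (\sum_i (g c)^-1 * `|g (r i) - g (l i)|)).
  apply: ler_sum => i _; have [al [ilr rb]] := lr i.
  apply: ln_lipschitz; first exact: g0.
    by apply: gc; rewrite in_itv/= al (le_trans (ltW ilr)).
  by apply: gc; rewrite in_itv/= rb (le_trans al (ltW ilr)).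
by rewrite -mulr_sumr ltr_pdivrMl ?g0// mulrC gd.
Qed.

(** * Integrals of functions not known to be measurable *)

(* The integral of a nonnegative function is a supremum over simple functions, so
   no measurability is needed; [derive1] of an interpolation is not known to be
   measurable for the (incomplete) Borel sigma-algebra. *)
Lemma ge0_le_integral_nonmeasurable d (T : measurableType d) (R : realType)
    (mu : {measure set T -> \bar R}) (D : set T) (f g : T -> \bar R) :
  (forall x, D x -> 0 <= f x)%E -> (forall x, D x -> f x <= g x)%E ->
  (\int[mu]_(x in D) f x <= \int[mu]_(x in D) g x)%E.
Proof.
move=> f0 fg.
have g0 x : D x -> (0 <= g x)%E by move=> Dx; exact: le_trans (f0 _ Dx) (fg _ Dx).
rewrite !ge0_integralE//; apply: le_ereal_sup => _ [h hf <-] /=.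
exists h => // x; apply: le_trans (hf x) _.
by rewrite !patchE; case: ifPn => // /set_mem; exact: fg.
Qed.

(** If [N] is the exceptional null set, [f] lies between [g] cut to [0] on [N] and [g] raised to
    [+oo] on [N]. Both bounds are measurable and almost everywhere equal to [g], so their integrals
    equal that of [g]. *)
Lemma ge0_ae_eq_integral_nonmeasurable d (T : measurableType d) (R : realType)
    (mu : {measure set T -> \bar R}) (D : set T) (f g : T -> \bar R) :
  measurable D -> measurable_fun D g ->
  (forall x, D x -> 0 <= f x)%E -> (forall x, D x -> 0 <= g x)%E ->
  ae_eq mu D f g ->
  (\int[mu]_(x in D) f x = \int[mu]_(x in D) g x)%E.
Proof.
move=> mD mg f0 g0 [N [mN N0 fgN]].
have fg x : D x -> ~ N x -> f x = g x.
  by move=> Dx Nx; apply: contrapT => fgx; apply: Nx; apply: fgN => /= /(_ Dx).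
have mI (A : set T) (k : \bar R) : measurable A ->
    measurable_fun D (fun x => k * (\1_A x)%:E)%E.
  by move=> mA; apply: measurable_funeM; apply/measurable_EFinP; exact: measurable_indic.
have aeN (u v : T -> \bar R) : (forall x, ~ N x -> u x = v x) -> ae_eq mu D u v.
  move=> uv; exists N; split => // x /=; apply: contra_notP => Nx _; exact: uv.
apply/eqP; rewrite eq_le; apply/andP; split.
  rewrite [leRHS](@ge0_ae_eq_integral _ _ _ mu D _ (fun x => g x + +oo * (\1_N x)%:E)%E)//.
  - apply: ge0_le_integral_nonmeasurable => // x Dx.
    have [Nx|Nx] := pselect (N x).
      rewrite indicE mem_set// mule1 addey ?leey//.
      by rewrite gt_eqF// (lt_le_trans ltNy0 (g0 _ Dx)).
    by rewrite indicE memNset// mule0 adde0 fg.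
  - by apply: emeasurable_funD => //; exact: mI.
  - by move=> x Dx; rewrite adde_ge0 ?g0// mule_ge0.
  - by apply: aeN => x Nx; rewrite indicE memNset// mule0 adde0.
rewrite [leLHS](@ge0_ae_eq_integral _ _ _ mu D _ (fun x => g x * (1 * (\1_(~` N) x)%:E))%E)//.
- apply: ge0_le_integral_nonmeasurable => x Dx.
    by rewrite mule_ge0 ?g0// mule_ge0.
  have [Nx|Nx] := pselect (N x).
    by rewrite indicE memNset ?mule0 ?f0//; exact.
  by rewrite indicE mem_set// !mule1 fg.
- by apply: emeasurable_funM => //; apply: mI; exact: measurableC.
- by move=> x Dx; rewrite mule_ge0 ?g0// mule_ge0.
- by apply: aeN => x Nx; rewrite indicE mem_set// !mule1.
Qed.

(** Derivatives are controlled at interior points, whereas the integrals run over the closed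
    interval. *)
Lemma ae_itv_oo_cc (R : realType) (a b : R) (P : R -> Prop) :
  {ae @lebesgue_measure R, forall t, t \in `]a, b[ -> P t} ->
  {ae @lebesgue_measure R, forall t, t \in `[a, b] -> P t}.
Proof.
move=> aeP; have set1_negl (x : R) : (@lebesgue_measure R).-negligible [set x].
  by exists [set x]; split => //; rewrite lebesgue_measure_set1.
have := negligibleU (negligibleU aeP (set1_negl a)) (set1_negl b).
apply: negligibleS => t /= /not_implyP[]; rewrite in_itv/= => /andP[].
rewrite le_eqVlt => /predU1P[<-|ta]; first by left; right.
rewrite le_eqVlt => /predU1P[<-|tb]; first by right.
by move=> nPt; left; left => /= Pt; apply/nPt/Pt; rewrite in_itv/= ta.
Qed.

(** * Velocities of log-coordinates and of geometric interpolations *)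

(** Provides a measurable representative [h] of the velocity. The [is_derive] form serves to
    differentiate interpolations, the [derive1] form to rewrite integrals, and the integral formula
    to recover the path. *)
Lemma admissible_log_density (R : realType) (a b : R) (g : R -> R) :
  a < b -> admissible a b g ->
  exists h : R -> R,
  [/\ measurable_fun setT h,
      forall x, a <= x <= b ->
        log_coord g x = log_coord g a + \int[@lebesgue_measure R]_(t in `]a, x]) h t,
      {ae @lebesgue_measure R, forall t, t \in `]a, b[ ->
        is_derive t 1 (log_coord g) (h t)} &
      {ae @lebesgue_measure R, forall t, t \in `[a, b] ->
        derive1 (log_coord g) t = h t}].
Proof.
move=> ab [g0 acg _].
have [h ih hE] := abs_cont_density _ _ _ _ ab (abs_cont_log_coord _ _ _ _ (ltW ab) g0 acg).
have aeh := ae_is_derive_of_density _ _ _ _ _ ih hE.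
exists h; split => //; first by apply/measurable_EFinP; exact: measurable_int ih.
apply: ae_itv_oo_cc; apply: filterS aeh;
  first exact: (ae_filter_ringOfSetsType (@lebesgue_measure R)).
by move=> t ht tab; have := ht tab => ?; rewrite derive1E derive_val.
Qed.

Lemma log_coord_geo_interp (R : realType) (g1 g2 : R -> R) (s t : R) :
  0 < g1 t -> 0 < g2 t ->
  log_coord (geo_interp g1 g2 s) t = (1 - s) * log_coord g1 t + s * log_coord g2 t.
Proof.
move=> g10 g20; rewrite /log_coord /geo_interp lnM ?posrE ?powR_gt0//.
by rewrite !ln_powR.
Qed.

(** Log-coordinates combine linearly where both paths are positive, which holds on a whole
    neighbourhood of an interior point. *)
Lemma geo_interp_derive (R : realType) (a b s : R) (g1 g2 h1 h2 : R -> R) (t : R) :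
  (forall x, x \in `[a, b] -> 0 < g1 x) -> (forall x, x \in `[a, b] -> 0 < g2 x) ->
  t \in `]a, b[ ->
  is_derive t 1 (log_coord g1) (h1 t) -> is_derive t 1 (log_coord g2) (h2 t) ->
  derive1 (log_coord (geo_interp g1 g2 s)) t = (1 - s) * h1 t + s * h2 t.
Proof.
move=> g10 g20; rewrite in_itv/= => /andP[ta tb] d1 d2.
have gE : \near t, ((1 - s) *: log_coord g1 + s *: log_coord g2 : R -> R) t =
    log_coord (geo_interp g1 g2 s) t.
  near=> x; have xab : x \in `[a, b].
    rewrite in_itv/=; apply/andP; split; apply/ltW; near: x.
      exact: lt_nbhsr.
    exact: lt_nbhsl.
  by rewrite log_coord_geo_interp ?g10 ?g20.
have ? : is_derive t 1 (log_coord (geo_interp g1 g2 s)) ((1 - s) * h1 t + s * h2 t).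
  by apply: near_eq_is_derive gE _; apply: is_deriveD.
by rewrite derive1E derive_val.
Unshelve. all: by end_near. Qed.

(** * Convexity of the action and the resulting gap *)

Lemma continuous_cosh (R : realType) : continuous (@cosh R).
Proof.
move=> x; rewrite /cosh; apply: cvgMl; apply: cvgD; first exact: continuous_expR.
by apply: continuous_comp; [exact: opp_continuous|exact: continuous_expR].
Qed.

Lemma measurable_coshB1 (R : realType) (h : R -> R) (D : set R) :
  measurable_fun D h -> measurable_fun D (fun t => (cosh (h t) - 1)%:E).
Proof.
move=> mh; apply/measurable_EFinP; apply: measurable_funB => //.
apply: measurableT_comp mh; apply: continuous_measurable_fun.
exact: continuous_cosh.
Qed.

Lemma action_density (R : realType) (a b : R) (g h : R -> R) :
  measurable_fun setT h ->
  {ae @lebesgue_measure R, forall t, t \in `[a, b] -> derive1 (log_coord g) t = h t} ->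
  action a b g = (\int[@lebesgue_measure R]_(t in `[a, b]) (cosh (h t) - 1)%:E)%E.
Proof.
move=> mh aeh; apply: ge0_ae_eq_integral_nonmeasurable => //.
- by apply: measurable_coshB1; exact: measurable_funTS.
- by move=> t _; rewrite lee_fin subr_ge0 cosh_ge1.
- by move=> t _; rewrite lee_fin subr_ge0 cosh_ge1.
- apply: filterS aeh;
  first exact: (ae_filter_ringOfSetsType (@lebesgue_measure R)).
  by move=> t /= ht tab; rewrite ht.
Qed.

(** Pointwise strong convexity, integrated. With the quadratic term on the left, every integral is
    of a nonnegative function and no infinite values are subtracted. *)
Lemma integral_cosh_convex (R : realType) (s : R) (h1 h2 : R -> R) (D : set R) :
  measurable D -> measurable_fun D h1 -> measurable_fun D h2 -> 0 <= s <= 1 ->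
  (\int[@lebesgue_measure R]_(t in D) (cosh ((1 - s) * h1 t + s * h2 t) - 1)%:E +
   (s * (1 - s) / 2)%:E * \int[@lebesgue_measure R]_(t in D) ((h1 t - h2 t) ^+ 2)%:E <=
   (1 - s)%:E * \int[@lebesgue_measure R]_(t in D) (cosh (h1 t) - 1)%:E +
   s%:E * \int[@lebesgue_measure R]_(t in D) (cosh (h2 t) - 1)%:E)%E.
Proof.
move=> mD mh1 mh2 s01; have /andP[s0 s1] := s01.
have coshB1_ge0 (x : R) : (0 <= (cosh x - 1)%:E)%E by rewrite lee_fin subr_ge0 cosh_ge1.
have sqr_ge0E (x : R) : (0 <= (x ^+ 2)%:E)%E by rewrite lee_fin sqr_ge0.
have mu : measurable_fun D (fun t => (1 - s) * h1 t + s * h2 t).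
  by apply: measurable_funD; apply: measurable_funM.
have msq : measurable_fun D (fun t => ((h1 t - h2 t) ^+ 2)%:E).
  by apply/measurable_EFinP; apply: measurable_funX; exact: measurable_funB.
have c0 : 0 <= s * (1 - s) / 2 by rewrite divr_ge0// mulr_ge0// subr_ge0.
have s'0 : 0 <= 1 - s by rewrite subr_ge0.
have m1 := measurable_coshB1 _ _ _ mh1; have m2 := measurable_coshB1 _ _ _ mh2.
have mM (k : R) (f : R -> \bar R) : measurable_fun D f ->
    measurable_fun D (fun t => k%:E * f t)%E.
  exact: measurable_funeM.
rewrite -!ge0_integralZl_EFin// -!ge0_integralD//;
  try by [exact: mM|exact: measurable_coshB1|move=> t _; rewrite mule_ge0].
apply: ge0_le_integral => //.
- by move=> t _; rewrite adde_ge0// mule_ge0.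
- by apply: emeasurable_funD; [exact: measurable_coshB1|exact: mM].
- by apply: emeasurable_funD; exact: mM.
move=> t _; rewrite -!EFinM -!EFinD lee_fin.
by have := cosh_sub_sqr_convex _ s (h1 t) (h2 t) s01; lra.
Qed.

(** Cancel [(1 - s) * A1] and divide by [s]. The premise is the convexity inequality with [A1] in
    place of the action of the interpolation. *)
Lemma convex_gap (R : realType) (s : R) (A1 A2 Q : \bar R) :
  0 < s -> s <= 1 -> (0 <= Q)%E -> A1 \is a fin_num -> A2 \is a fin_num ->
  (A1 + (s * (1 - s) / 2)%:E * Q <= (1 - s)%:E * A1 + s%:E * A2)%E ->
  [/\ (A1 <= A2 - ((1 - s) / 2)%:E * Q)%E, (A1 <= A2)%E &
      s < 1 -> Q <> 0%E -> (A1 < A2)%E].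
Proof.
move=> s0 s1 Q0; case: A1 => // x _; case: A2 => // y _.
(* At [s = 1] the coefficient of [Q] is zero, and [0 * Q = 0] even for infinite [Q]. *)
have [/eqP|sn1] := boolP (s == 1).
  move=> ->; rewrite subrr mulr0 !mul0r !mul0e adde0 add0e mul1e => xy.
  by split; rewrite ?sube0// ltxx.
have {sn1} s1' : s < 1 by rewrite lt_neqAle sn1.
have c0 : 0 < s * (1 - s) / 2 by rewrite divr_gt0// mulr_gt0// subr_gt0.
(* Now the coefficient is positive, so an infinite [Q] would contradict the finite right-hand
   side. *)
case: Q Q0 => [q| |]//; last by rewrite gt0_muley ?lte_fin.
rewrite -!EFinM -!EFinD -?EFinB !lee_fin lte_fin => q0 conv.
have main : x <= y - (1 - s) / 2 * q by rewrite -(ler_pM2l s0); lra.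
have sq0 : 0 <= (1 - s) / 2 * q by rewrite mulr_ge0// divr_ge0// subr_ge0.
split => //; first by lra.
move=> _ qn0; have q_gt0 : 0 < q.
  by rewrite lt_neqAle q0 andbT; apply/eqP => qE; apply: qn0; rewrite -qE.
suff : 0 < (1 - s) / 2 * q by lra.
by rewrite mulr_gt0// divr_gt0// subr_gt0.
Qed.

Theorem theorem4p5 (R : realType) (a b : R) (ggeo gother : R -> R) (s0 : R)
    (ab : a < b)
    (adm_geo : kin_admissible a b ggeo)
    (adm_other : kin_admissible a b gother)
    (eq_a : ggeo a = gother a) (eq_b : ggeo b = gother b)
    (s0_gt0 : 0 < s0) (s0_le1 : s0 <= 1)
    (min_s0 : (action a b ggeo <=
               action a b (geo_interp ggeo gother s0))%E) :
  [/\ (action a b ggeo <= action a b gother -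
         ((1 - s0) / 2)%:E *
         \int[@lebesgue_measure R]_(t in `[a, b])
           ((derive1 (log_coord ggeo) t - derive1 (log_coord gother) t) ^+ 2)%:E)%E,
      (action a b ggeo <= action a b gother)%E &
      s0 < 1 -> ~ {in `[a, b], gother =1 ggeo} ->
      (action a b ggeo < action a b gother)%E].
Proof.
have [admg Afin1] := adm_geo; have [admo Afin2] := adm_other.
have [h1 [mh1 h1E dh1 ae1]] := admissible_log_density _ _ _ _ ab admg.
have [h2 [mh2 h2E dh2 ae2]] := admissible_log_density _ _ _ _ ab admo.
have [g10 _ _] := admg; have [g20 _ _] := admo.
pose mu := @lebesgue_measure R.
have aes : {ae mu, forall t, t \in `[a, b] ->
    derive1 (log_coord (geo_interp ggeo gother s0)) t = (1 - s0) * h1 t + s0 * h2 t}.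
  apply: ae_itv_oo_cc; apply: (filterS2 (F := almost_everywhere mu)) dh1 dh2.
  by move=> t d1 d2 tab; apply: (geo_interp_derive _ a b) => //; [exact: d1|exact: d2].
have QE : (\int[mu]_(t in `[a, b])
     ((derive1 (log_coord ggeo) t - derive1 (log_coord gother) t) ^+ 2)%:E =
   \int[mu]_(t in `[a, b]) ((h1 t - h2 t) ^+ 2)%:E)%E.
  apply: ge0_ae_eq_integral_nonmeasurable => //.
  - apply/measurable_EFinP; apply: measurable_funX; apply: measurable_funB;
      exact: measurable_funTS.
  - by move=> t _; rewrite lee_fin sqr_ge0.
  - by move=> t _; rewrite lee_fin sqr_ge0.
  - by apply: (filterS2 (F := almost_everywhere mu)) ae1 ae2 => t /= e1 e2 tab; rewrite e1// e2.
have s01 : 0 <= s0 <= 1 by rewrite ltW.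
have := integral_cosh_convex _ s0 h1 h2 `[a, b]%classic _ _ _ s01.
rewrite -(action_density _ a b _ _ mh1 ae1) -(action_density _ a b _ _ mh2 ae2).
rewrite -(action_density _ a b _ _ _ aes); last first.
  by apply: measurable_funD; apply: measurable_funM.
move=> /(_ (measurable_itv _) (measurable_funTS mh1) (measurable_funTS mh2)) conv.
rewrite -/mu QE; set Q := (\int[mu]_(t in _) _)%E in conv *.
have Q0 : (0 <= Q)%E by apply: integral_ge0 => t _; rewrite lee_fin sqr_ge0.
have A0 g : (0 <= action a b g)%E.
  by apply: integral_ge0 => t _; rewrite lee_fin subr_ge0 cosh_ge1.
(* The hypothesis at [s0] replaces the action of the interpolation by that of [ggeo]. *)
have {}conv := le_trans (leeD2r _ min_s0) conv.
have A1f : action a b ggeo \is a fin_num.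
  by rewrite ge0_fin_numE; [exact: Afin1|exact: A0].
have A2f : action a b gother \is a fin_num.
  by rewrite ge0_fin_numE; [exact: Afin2|exact: A0].
have [gap le12 lt12] := convex_gap _ _ _ _ _ s0_gt0 s0_le1 Q0 A1f A2f conv.
(* Strictness by contraposition: if the gap integral [Q] vanishes, the paths coincide. *)
split; [exact: gap|exact: le12|] => s1 gne; apply: lt12 => // Q_eq0; apply: gne.
have aeh : ae_eq mu `[a, b]%classic (EFin \o h1) (EFin \o h2).
  have msq : measurable_fun `[a, b]%classic (fun t => ((h1 t - h2 t) ^+ 2)%:E).
    apply/measurable_EFinP; apply: measurable_funX; apply: measurable_funB;
      exact: measurable_funTS.
  have : ae_eq mu `[a, b]%classic (fun t => ((h1 t - h2 t) ^+ 2)%:E) (cst 0%E).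
    apply/ae_eq_integral_abs => //; rewrite -[RHS]Q_eq0.
    by apply: eq_integral => t _; rewrite gee0_abs// lee_fin sqr_ge0.
  move=> sq0; apply: (filterS (F := almost_everywhere mu)) sq0.
  move=> t /= sq0 tab; have [/eqP] := sq0 tab.
  by rewrite sqrf_eq0 subr_eq0 => /eqP ->.
move=> t; rewrite in_itv/= => /andP[at_ tb].
have tab : t \in `[a, b] by rewrite in_itv/= at_.
(* Both log-coordinates start from the same value by [eq_a] and are primitives of almost everywhere
   equal densities. *)
apply: ln_inj; rewrite ?posrE ?g10 ?g20//.
have := h1E t; have := h2E t; rewrite /log_coord at_ tb eq_a => -> // -> //.
congr (_ + fine _); apply: ae_eq_integral => //.
- by apply/measurable_EFinP; exact: measurable_funTS.
- by apply/measurable_EFinP; exact: measurable_funTS.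
- apply: ae_eq_subset (ae_eq_sym aeh) => x /=; rewrite !in_itv/= => /andP[/ltW -> xt].
  exact: le_trans xt tb.
Qed.
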